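(* Let $n\ge 4$. If $H\in\mathcal{H}_2$ is such that the polynomial $g_H$ is squarefree, then $H\in\mathcal{H}_{\mathrm{red}}$.
   Context: For $m\in\mathbb{N}$ let $\mathcal{T}_m=\{(i,j,k)\in\mathbb{N}^3\mid i+j+k=m\}$ (with $0\in\mathbb{N}$), and let $\mathcal{T}'=\mathcal{T}_n\setminus\{(n,0,0),(0,n,0),(0,0,n)\}$. A maximal segment of $\mathcal{T}'$ is a subset with at least two points that is a maximal (with respect to inclusion) subset of collinear points of $\mathcal{T}'$. Let $\mathcal{H}_2$ be the set of all maximal segments of $\mathcal{T}'$ other than the three sets $\{(0,j,k)\mid j+k=n,\ j,k>0\}$, $\{(i,0,k)\mid i+k=n,\ i,k>0\}$, $\{(i,j,0)\mid i+j=n,\ i,j>0\}$. Define the polynomial $g_H$ as follows. Let $a,b,c$ be coefficients with $a\neq0$, and let $d_{0jk}$ ($j+k=n-2$), $e_{ijk}$, $f_{ijk}$ ($(i,j,k)\in\mathcal{T}_{n-2}$) be coefficients. Define on $\mathcal{T}'$: - $\phi_D(i,j,k)=d_{0\,j-1\,k-1}$ if $i=0$ and $j,k>0$, and $0$ otherwise; - $\phi_E(i,j,k)=e_{i-1\,j\,k-1}$ if $i,k>0$, and $0$ otherwise; - $\phi_F(i,j,k)=f_{i-1\,j-1\,k}$ if $i,j>0$, and $0$ otherwise. Put $D_H=\sum_{(i,j,k)\in H}\phi_D(i,j,k)x^iy^{j-1}z^{k-1}$, $E_H=\sum_{(i,j,k)\in H}\phi_E(i,j,k)x^{i-1}y^jz^{k-1}$,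 $F_H=\sum_{(i,j,k)\in H}\phi_F(i,j,k)x^{i-1}y^{j-1}z^k$ (summands with coefficient $0$ are $0$), and $$g_H=\frac1n\det\begin{pmatrix}x&ax&D_H\\ y&by&E_H\\ z&cz&F_H\end{pmatrix}.$$ Define - $\Gamma_1=\{(n-1,1,0),(n-1,0,1),(n-2,1,1)\}$, - $\Gamma_2=\{(0,n-1,1),(1,n-1,0),(1,n-2,1)\}$, - $\Gamma_3=\{(0,1,n-1),(1,0,n-1),(1,1,n-2)\}$, - $\Delta_1=\{(i,j,k)\in\mathcal{T}'\mid i\in\{0,1\}\}$, - $\Delta_2=\{(i,j,k)\in\mathcal{T}'\mid j\in\{0,1\}\}$, - $\Delta_3=\{(i,j,k)\in\mathcal{T}'\mid k\in\{0,1\}\}$, and $\mathcal{H}_{\mathrm{red}}=\{H\in\mathcal{H}_2\mid \text{there exists }\ell\in\{1,2,3\}\text{ with }H\cap\Gamma_\ell\neq\emptyset\text{ and }H\cap\Delta_\ell\neq\emptyset\}$. *)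

(* Defs.v *)
From mathcomp Require Import all_boot all_order all_algebra.
From mathcomp Require Import finmap mpoly.

Set Implicit Arguments.
Unset Strict Implicit.
Unset Printing Implicit Defensive.

Import GRing.Theory.

Local Open Scope fset_scope.
Local Open Scope ring_scope.

Definition point : Type := (nat * nat * nat)%type.

Section Triangle.

Variable n : nat.

Definition triangle (m : nat) : {pred point} :=
  fun '(i, j, k) => (i + j + k == m)%N.

Definition triangle' : {pred point} :=
  fun p => (p \in triangle n) &&
           (p \notin [:: (n, 0, 0); (0, n, 0); (0, 0, n)]%N).

Definition vec_of_point (p : point) : 'rV[rat]_3 :=
  let '(i, j, k) := p in \row_(t < 3) (nth 0%N [:: i; j; k] t)%:R.

(* The points have integer coordinates, so they lie on a line of R^3 if and
   only if they lie on a line of Q^3. *)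
Definition collinear (S : {fset point}) : Prop :=
  exists u v : 'rV[rat]_3, v != 0 /\
    forall p, p \in S -> exists t : rat, vec_of_point p = u + t *: v.

Definition maximal_segment (H : {fset point}) : Prop :=
  [/\ {subset H <= triangle'},
      (2 <= #|` H|)%N,
      collinear H &
      forall S : {fset point},
        {subset S <= triangle'} -> collinear S -> H `<=` S -> S = H].

Definition edge1 : {pred point} :=
  fun '(i, j, k) => [&& i == 0, j + k == n, 0 < j & 0 < k]%N.
Definition edge2 : {pred point} :=
  fun '(i, j, k) => [&& j == 0, i + k == n, 0 < i & 0 < k]%N.
Definition edge3 : {pred point} :=
  fun '(i, j, k) => [&& k == 0, i + j == n, 0 < i & 0 < j]%N.

Definition H2 (H : {fset point}) : Prop :=
  [/\ maximal_segment H, ~ (H =i edge1), ~ (H =i edge2) & ~ (H =i edge3)].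

Definition Gamma1 : {pred point} :=
  fun p => p \in [:: (n - 1, 1, 0); (n - 1, 0, 1); (n - 2, 1, 1)]%N.
Definition Gamma2 : {pred point} :=
  fun p => p \in [:: (0, n - 1, 1); (1, n - 1, 0); (1, n - 2, 1)]%N.
Definition Gamma3 : {pred point} :=
  fun p => p \in [:: (0, 1, n - 1); (1, 0, n - 1); (1, 1, n - 2)]%N.

Definition Delta1 : {pred point} :=
  fun p => (p \in triangle') && (let '(i, j, k) := p in i \in [:: 0; 1]%N).
Definition Delta2 : {pred point} :=
  fun p => (p \in triangle') && (let '(i, j, k) := p in j \in [:: 0; 1]%N).
Definition Delta3 : {pred point} :=
  fun p => (p \in triangle') && (let '(i, j, k) := p in k \in [:: 0; 1]%N).

Definition meets (H : {fset point}) (A : {pred point}) : Prop :=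
  exists2 p, p \in H & p \in A.

Definition Hred (H : {fset point}) : Prop :=
  H2 H /\ [\/ meets H Gamma1 /\ meets H Delta1,
              meets H Gamma2 /\ meets H Delta2 |
              meets H Gamma3 /\ meets H Delta3].

End Triangle.

Section Polynomial.

Variables (K : fieldType) (n : nat) (a b c : K).
(* On points of [triangle' n] the functions [phiD], [phiE], [phiF] only use
   the values [d 0 j k], [e i j k], [f i j k] whose indices sum to [n - 2]. *)
Variables (d e f : nat -> nat -> nat -> K).

Definition phiD (p : point) : K := let '(i, j, k) := p in
  if [&& i == 0, 0 < j & 0 < k]%N then d 0 j.-1 k.-1 else 0.
Definition phiE (p : point) : K := let '(i, j, k) := p in
  if [&& 0 < i & 0 < k]%N then e i.-1 j k.-1 else 0.
Definition phiF (p : point) : K := let '(i, j, k) := p in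
  if [&& 0 < i & 0 < j]%N then f i.-1 j.-1 k else 0.

Definition X : {mpoly K[3]} := 'X_(@Ordinal 3 0 isT).
Definition Y : {mpoly K[3]} := 'X_(@Ordinal 3 1 isT).
Definition Z : {mpoly K[3]} := 'X_(@Ordinal 3 2 isT).

(* Truncated predecessors are harmless below: a zero exponent is only
   decremented in a summand whose coefficient is zero. *)
Definition DH (H : {fset point}) : {mpoly K[3]} :=
  \sum_(p <- H) let '(i, j, k) := p in
    phiD p *: (X ^+ i * Y ^+ j.-1 * Z ^+ k.-1).
Definition EH (H : {fset point}) : {mpoly K[3]} :=
  \sum_(p <- H) let '(i, j, k) := p in
    phiE p *: (X ^+ i.-1 * Y ^+ j * Z ^+ k.-1).
Definition FH (H : {fset point}) : {mpoly K[3]} :=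
  \sum_(p <- H) let '(i, j, k) := p in
    phiF p *: (X ^+ i.-1 * Y ^+ j.-1 * Z ^+ k).

Definition gH (H : {fset point}) : {mpoly K[3]} :=
  n%:R^-1 *: \det (\matrix_(r < 3, s < 3)
    nth 0 (nth [::] [:: [:: X; a *: X; DH H];
                        [:: Y; b *: Y; EH H];
                        [:: Z; c *: Z; FH H]] r) s).

End Polynomial.

(* In particular the zero polynomial is not squarefree. *)
Definition squarefree (K : fieldType) (m : nat) (p : {mpoly K[m]}) : Prop :=
  forall q r : {mpoly K[m]}, p = q ^+ 2 * r -> q \is a GRing.unit.

(* Main.v *)
(** Expanding the determinant along its third column shows that [gH] is a
    linear combination of the monomials [x^i y^j z^k] with [(i, j, k)] in [H].
    Being squarefree, it is divisible by none of [x^2], [y^2], [z^2], so [H]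
    meets each of [Delta1], [Delta2], [Delta3]. Choose a point of [H] in each;
    these are collinear, so one of them lies weakly between the other two. Its
    small coordinate is then at least the minimum of that coordinate at the
    other two points, so one of these has two coordinates at most [1]. Such a
    point lies in some [Gamma]. *)

Require Import Defs.
From mathcomp Require Import all_boot all_order all_algebra.
From mathcomp Require Import finmap mpoly.
From mathcomp Require Import ring zify.

Set Implicit Arguments.
Unset Strict Implicit.
Unset Printing Implicit Defensive.

Local Open Scope ring_scope.

Import Order.TTheory GRing.Theory Num.Theory.

Definition o0 : 'I_3 := @Ordinal 3 0 isT.
Definition o1 : 'I_3 := @Ordinal 3 1 isT.
Definition o2 : 'I_3 := @Ordinal 3 2 isT.

Definition coord (l : 'I_3) (p : point) : nat :=
  let '(i, j, k) := p in nth 0%N [:: i; j; k] l.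

(** Only this coordinatewise consequence of [q] lying weakly between [p] and [r] is kept, since it
    is what transfers a small coordinate from [q] to an endpoint. *)
Definition between (p q r : point) : Prop :=
  forall l, (minn (coord l p) (coord l r) <= coord l q)%N.

Lemma betweenC (p q r : point) : between p q r -> between r q p.
Proof. by move=> pqr l; rewrite minnC. Qed.

Lemma vec_of_pointE (p : point) (l : 'I_3) :
  vec_of_point p 0 l = (coord l p)%:R.
Proof. by case: p => -[i j] k; rewrite mxE. Qed.

(** Each coordinate is affine in the parameter, hence monotone; the sign of [v 0 l] decides which
    endpoint bounds it from below. *)
Lemma between_param (u v : 'rV[rat]_3) (p q r : point) (s t w : rat) :
  vec_of_point p = u + s *: v -> vec_of_point q = u + t *: v ->
  vec_of_point r = u + w *: v -> s <= t <= w -> between p q r.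
Proof.
move=> pE qE rE /andP[st tw] l.
move/rowP/(_ l): pE; move/rowP/(_ l): qE; move/rowP/(_ l): rE.
rewrite !vec_of_pointE !mxE.
move: (coord l p) (coord l q) (coord l r) => x y z zE yE xE.
rewrite geq_min -!(ler_nat rat) xE yE zE !lerD2l.
have [v0|v0] := leP 0 (v 0 l).
  by rewrite ler_wpM2r.
by rewrite orbC ler_wnM2r // ltW.
Qed.

Lemma collinear_between (S : {fset point}) (p q r : point) :
  collinear S -> p \in S -> q \in S -> r \in S ->
  [\/ between q p r, between p q r | between p r q].
Proof.
move=> [u [v [_ uvP]]] /uvP[s pE] /uvP[t qE] /uvP[w rE].
have [st|/ltW ts] := leP s t; have [tw|/ltW wt] := leP t w.
- by apply: Or32; apply: (between_param pE qE rE); rewrite st.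
- have [sw|/ltW ws] := leP s w.
    by apply: Or33; apply: (between_param pE rE qE); rewrite sw.
  by apply/Or31/betweenC/(between_param rE pE qE); rewrite ws.
- have [sw|/ltW ws] := leP s w.
    by apply/Or31/(between_param qE pE rE); rewrite ts.
  by apply/Or33/betweenC/(between_param qE rE pE); rewrite tw.
- by apply/Or32/betweenC/(between_param rE qE pE); rewrite wt.
Qed.

Lemma mpolyX_nonunit (K : fieldType) (m : nat) (l : 'I_m) :
  'X_l \isn't a @GRing.unit {mpoly K[m]}.
Proof.
(* Evaluation at the origin kills the variable and would turn an inverse relation into [0 = 1]. *)
apply/negP => /mulrV /(congr1 (meval (fun=> 0))).
rewrite rmorphM /= mevalXU mul0r rmorph1 => /esym/eqP.
by rewrite oner_eq0.
Qed.

Lemma det_mx33 (R : comNzRingType) (F : nat -> nat -> R) :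
  \det (\matrix_(r < 3, s < 3) F r s) =
    F 0 2 * (F 1 0 * F 2 1 - F 2 0 * F 1 1)
  - F 1 2 * (F 0 0 * F 2 1 - F 2 0 * F 0 1)
  + F 2 2 * (F 0 0 * F 1 1 - F 1 0 * F 0 1).
Proof.
rewrite (expand_det_row _ ord0) !big_ord_recl big_ord0 /cofactor.
rewrite !(expand_det_row _ ord0) !big_ord_recl !big_ord0 /cofactor.
by rewrite !det_mx11 !mxE /= /bump /=; ring.
Qed.

Section GH.

Variables (K : fieldType) (n : nat) (a b c : K).
Variables (d e f : nat -> nat -> nat -> K).

Definition gH_coef (p : point) : K :=
  n%:R^-1 * ((c - b) * phiD d p - (c - a) * phiE e p + (b - a) * phiF f p).

Lemma gHE (H : {fset point}) :
  gH n a b c d e f H =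
  \sum_(p <- H) gH_coef p *: \prod_(l < 3) 'X_l ^+ coord l p.
Proof.
have -> : gH n a b c d e f H = n%:R^-1 *: ((c - b) *: (Y K * Z K * DH d H)
    - (c - a) *: (X K * Z K * EH e H) + (b - a) *: (X K * Y K * FH f H)).
  congr (_ *: _); rewrite (det_mx33 (fun r s => nth 0 (nth [::] _ r) s)) /=.
  rewrite -!mul_mpolyC !rmorphB /=.
  generalize (DH d H) (EH e H) (FH f H) (X K) (Y K) (Z K) => D E F x y z.
  by ring.
rewrite /DH /EH /FH !mulr_sumr !scaler_sumr -sumrB -big_split /= scaler_sumr.
apply: eq_bigr => -[[i j] k] _.
have -> : \prod_(l < 3) 'X_l ^+ coord l (i, j, k)
    = X K ^+ i * Y K ^+ j * Z K ^+ k :> {mpoly K[3]}.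
  rewrite !big_ord_recl big_ord0 mulr1 mulrA.
  by congr ('X_ _ ^+ _ * 'X_ _ ^+ _ * 'X_ _ ^+ _); apply: val_inj.
rewrite /gH_coef /phiD /phiE /phiF.
(* Splitting zero from successor settles the tests in [phiD], [phiE], [phiF]. Where a predecessor
   truncates, the coefficient is zero; elsewhere the minor restores the lowered exponents. *)
case: i => [|i]; case: j => [|j]; case: k => [|k] /=.
all: rewrite -?mul_mpolyC !(rmorphM, rmorphD, rmorphB, rmorph0) /= ?exprS.
all: ring.
Qed.

Lemma squarefree_coord (H : {fset point}) (l : 'I_3) :
  squarefree (gH n a b c d e f H) -> exists2 p, p \in H & (coord l p <= 1)%N.
Proof.
move=> sqf.
have [/hasP[p pH lp]|/hasPn big] := boolP (has (fun p => coord l p <= 1)%N H).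
  by exists p.
case/negP: (mpolyX_nonunit K l).
(* The cofactor is [gH] with ['X_l ^+ 2] removed from every monomial; the subtraction is exact
   because [coord l p] is at least 2 throughout [H]. *)
apply: (sqf _ (\sum_(p <- H) gH_coef p *:
  ('X_l ^+ (coord l p - 2) * \prod_(t < 3 | t != l) 'X_t ^+ coord t p))).
rewrite gHE mulr_sumr; apply: eq_big_seq => p /big; rewrite -ltnNge => lp.
by rewrite -scalerAr mulrA -exprD subnKC // (bigD1 l).
Qed.

End GH.

(** The two small coordinates leave four points of the triangle, one of which is the excluded
    vertex. *)
Lemma mem_Gamma1 (n : nat) (p : point) : (4 <= n)%N -> p \in triangle' n ->
  (coord o1 p <= 1)%N -> (coord o2 p <= 1)%N -> p \in Gamma1 n.
Proof. case: p => -[i j] k; rewrite !unfold_in /= !xpair_eqE; lia. Qed.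

Lemma mem_Delta1 (n : nat) (p : point) :
  p \in triangle' n -> (coord o0 p <= 1)%N -> p \in Delta1 n.
Proof.
by case: p => -[i j] k pT /= s; apply/andP; split=> //=; rewrite !inE; lia.
Qed.

Lemma mem_Gamma2 (n : nat) (p : point) : (4 <= n)%N -> p \in triangle' n ->
  (coord o0 p <= 1)%N -> (coord o2 p <= 1)%N -> p \in Gamma2 n.
Proof. case: p => -[i j] k; rewrite !unfold_in /= !xpair_eqE; lia. Qed.

Lemma mem_Delta2 (n : nat) (p : point) :
  p \in triangle' n -> (coord o1 p <= 1)%N -> p \in Delta2 n.
Proof.
by case: p => -[i j] k pT /= s; apply/andP; split=> //=; rewrite !inE; lia.
Qed.

Lemma mem_Gamma3 (n : nat) (p : point) : (4 <= n)%N -> p \in triangle' n ->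
  (coord o0 p <= 1)%N -> (coord o1 p <= 1)%N -> p \in Gamma3 n.
Proof. case: p => -[i j] k; rewrite !unfold_in /= !xpair_eqE; lia. Qed.

Lemma mem_Delta3 (n : nat) (p : point) :
  p \in triangle' n -> (coord o2 p <= 1)%N -> p \in Delta3 n.
Proof.
by case: p => -[i j] k pT /= s; apply/andP; split=> //=; rewrite !inE; lia.
Qed.

Theorem lemma6p5 (K : fieldType) (n : nat) (a b c : K)
    (d e f : nat -> nat -> nat -> K) (H : {fset point})
    (hK : n%:R != 0 :> K) (hn : (4 <= n)%N) (ha : a != 0)
    (hH : H2 n H) (hg : squarefree (gH n a b c d e f H)) :
  Hred n H.
Proof.
split=> //.
have [[HT _ colH _] _ _ _] := hH.
have [p pH px] := squarefree_coord o0 hg.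
have [q qH qy] := squarefree_coord o1 hg.
have [r rH rz] := squarefree_coord o2 hg.
(* With every [Delta] met, it remains to find a point of [H] in any one [Gamma]. *)
have mD1 : meets H (Delta1 n) by exists p; rewrite ?mem_Delta1 ?HT.
have mD2 : meets H (Delta2 n) by exists q; rewrite ?mem_Delta2 ?HT.
have mD3 : meets H (Delta3 n) by exists r; rewrite ?mem_Delta3 ?HT.
case: (collinear_between colH pH qH rH).
(* The bound on the first coordinate of [p] passes to [q] or [r], which already has another small
   coordinate; the other two cases are analogous. *)
- move=> /(_ o0)/leq_trans/(_ px); rewrite geq_min => /orP[qx|rx].
    by apply: Or33; split=> //; exists q; rewrite ?mem_Gamma3 ?HT.
  by apply: Or32; split=> //; exists r; rewrite ?mem_Gamma2 ?HT.
- move=> /(_ o1)/leq_trans/(_ qy); rewrite geq_min => /orP[py|ry].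
    by apply: Or33; split=> //; exists p; rewrite ?mem_Gamma3 ?HT.
  by apply: Or31; split=> //; exists r; rewrite ?mem_Gamma1 ?HT.
- move=> /(_ o2)/leq_trans/(_ rz); rewrite geq_min => /orP[pz|qz].
    by apply: Or32; split=> //; exists p; rewrite ?mem_Gamma2 ?HT.
  by apply: Or31; split=> //; exists q; rewrite ?mem_Gamma1 ?HT.
Qed.
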